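(* Let $\mathbb{K}$ be a field of characteristic zero and $Y=(y_i)_{i\in\mathbb{N}}$ an alphabet indexed by the additive semigroup $\mathbb{N}$. An element $\sum_{\underline{y}\in Y^*} M^{\underline{y}}\,\underline{y}\in\mathbb{K}\langle\langle Y\rangle\rangle$ is primitive for the coproduct $\Delta_*$ (i.e., writing $P$ for it, $\Delta_*(P)=P\otimes 1+1\otimes P$) if and only if $M^\bullet$ is an alternel mould.
   Context: $Y^*$ is the set of words (finite sequences) of letters of $Y$, including the empty word $\emptyset=1$; by convention the symbol $y_0$ stands for the empty word $\emptyset=1$. $\mathbb{K}\langle\langle Y\rangle\rangle$ is the $\mathbb{K}$-algebra of non-commutative formal power series on $Y$. The coproduct $\Delta_*$ on $\mathbb{K}\langle\langle Y\rangle\rangle$ is defined on letters by $\Delta_*(y_r)=\sum_{i+j=r} y_i\otimes y_j$ (with $0\le i,j\le r$), on words by $\Delta_*(\underline{y}^1\underline{y}^2)=\Delta_*(\underline{y}^1)\Delta_*(\underline{y}^2)$ for all $\underline{y}^1,\underline{y}^2\in Y^*$, and is extended by linearity. A mould on $Y$ with values in $\mathbb{K}$ is a map $M^\bullet:Y^*\to\mathbb{K}$, $\underline{y}\mapsto M^{\underline{y}}$. For words $\underline{y}^1,\underline{y}^2$, the contracting shuffle $\mathrm{csh}(\underline{y}^1,\underline{y}^2)$ is the set of sequences obtained by shuffling $\underline{y}^1$ and $\underline{y}^2$ (mixing their elements while preserving the internal order of each), followed by the possible contraction $(y_{i},y_{j})\mapsto y_{i+j}$ of one or several pairs $(y_i,y_j)$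 of consecutive elements coming from $\underline{y}^1$ and $\underline{y}^2$ respectively. The mould $M^\bullet$ is called alternel if $\sum_{\underline{y}\in\mathrm{csh}(\underline{y}^1,\underline{y}^2)}M^{\underline{y}}=0$ for all $\underline{y}^1,\underline{y}^2\in Y^*\setminus\{\emptyset\}$.
   Formalization: The alternel side also requires that M vanish at the empty word, since the series 1 has an alternel mould but is not primitive; the contracting shuffle is taken with multiplicity, not as a bare set. *)

(* Defs.v *)
From HB Require Import structures.
From mathcomp Require Import all_boot all_order all_algebra.
From mathcomp Require Import boolp classical_sets functions cardinality fsbigop.

Set Implicit Arguments.
Unset Strict Implicit.
Unset Printing Implicit Defensive.

Import GRing.Theory.
Local Open Scope classical_set_scope.
Local Open Scope ring_scope.

(* The letters are the y_i with i >= 1, since y_0 denotes the empty word. *)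
Definition letter : Type := {i : nat | (0 < i)%N}.

Definition word : Type := seq letter.

Definition y (i : nat) : word :=
  if insub i is Some a then [:: a : letter] else [::].

Lemma add_letter_proof (a b : letter) : (0 < sval a + sval b)%N.
Proof. by rewrite addn_gt0 (svalP a). Qed.

Definition add_letter (a b : letter) : letter :=
  exist _ (sval a + sval b)%N (add_letter_proof a b).

Section Series.
Variable K : fieldType.

(* A formal series is its family of coefficients.  Beware that functions also
   carry a pointwise product in the library, which is never used here. *)
Definition ncseries : Type := word -> K.

(* The completed tensor product of K<<Y>> with itself: F (u, v) is the
   coefficient of u (x) v. *)
Definition ncseries2 : Type := (word * word)%type -> K.

Definition of_word (u : word) : ncseries := fun w => (w == u)%:R.

Definition tens (P Q : ncseries) : ncseries2 := fun p => P p.1 * Q p.2.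

(* Continuous bilinear extension of
   (u1 (x) v1) (u2 (x) v2) = (u1 ++ u2) (x) (v1 ++ v2). *)
Definition mul2 (F G : ncseries2) : ncseries2 := fun p =>
  \sum_(i < (size p.1).+1) \sum_(j < (size p.2).+1)
    F (take i p.1, take j p.2) * G (drop i p.1, drop j p.2).

Definition one2 : ncseries2 := tens (of_word [::]) (of_word [::]).

Definition Delta_letter (a : letter) : ncseries2 := fun p =>
  \sum_(i < (sval a).+1) tens (of_word (y i)) (of_word (y (sval a - i))) p.

Definition Delta_word (w : word) : ncseries2 :=
  \big[mul2/one2]_(a <- w) Delta_letter a.

(* The sum over all words has finite support, see finite_Delta_word. *)
Definition Delta (P : ncseries) : ncseries2 := fun p =>
  \sum_(w \in [set: word]) P w * Delta_word w p.

Definition primitive (P : ncseries) : Prop :=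
  Delta P = tens P (of_word [::]) + tens (of_word [::]) P.

Definition mould : Type := word -> K.

(* The series \sum_w M^w w. *)
Definition series_of_mould (M : mould) : ncseries := fun w => M w.

End Series.

(* All shuffles of s and t, each one listed with its multiplicity. *)
Fixpoint shuffle (T : Type) (s t : seq T) {struct s} : seq (seq T) :=
  if s is a :: s' then
    (fix shuffle_s t :=
       if t is b :: t' then
         map (cons a) (shuffle s' t) ++ map (cons b) (shuffle_s t')
       else [:: s]) t
  else [:: t].

Definition untag (x : letter + letter) : letter :=
  match x with inl a => a | inr b => b end.

(* All ways of contracting some (possibly no) pairs of consecutive elements
   whose first entry comes from the left word (inl) and whose second entry
   comes from the right word (inr). *)
Fixpoint contractions (s : seq (letter + letter)) : seq word :=
  if s is x :: s' then
    map (cons (untag x)) (contractions s') ++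
    match x, s' with
    | inl a, inr b :: s'' => map (cons (add_letter a b)) (contractions s'')
    | _, _ => [::]
    end
  else [:: [::]].

(* A list and not a set: sequences occur with multiplicity, so that for
   instance csh(y_1, y_1) consists of y_1 y_1 twice and of y_2 once. *)
Definition csh (u v : word) : seq word :=
  flatten (map contractions (shuffle (map inl u) (map inr v))).

(* The coefficient M^[::] is unconstrained: [::] is never in csh u v when u and
   v are nonempty.  The series 1 thus has an alternel mould, although it is not
   primitive. *)
Definition alternel (K : fieldType) (M : mould K) : Prop :=
  forall u v : word, u != [::] -> v != [::] -> \sum_(w <- csh u v) M w = 0.

(* Delta_word is homogeneous for the weight, and there are finitely many words
   of a given weight. *)
Section FiniteSupport.
Variable K : fieldType.

Let weight (w : word) : nat := sumn (map sval w).

Lemma weight_y i : weight (y i) = i.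
Proof.
rewrite /weight /y; case: insubP => [a _ <-|] /=; first by rewrite addn0.
by rewrite -eqn0Ngt => /eqP ->.
Qed.

Lemma Delta_letter_weight a p :
  @Delta_letter K a p != 0 -> (weight p.1 + weight p.2)%N = sval a.
Proof.
rewrite /Delta_letter => h; apply/eqP; apply: contraNT h => h.
apply/eqP/big1 => i _; rewrite /tens /of_word.
case: eqP => [e1|]; last by rewrite mul0r.
case: eqP => [e2|]; last by rewrite mulr0.
by move: h; rewrite e1 e2 !weight_y subnKC ?eqxx // -ltnS ltn_ord.
Qed.

Lemma Delta_word_weight w p :
  Delta_word K w p != 0 -> (weight p.1 + weight p.2)%N = weight w.
Proof.
elim: w p => [|a w IH] [u v]; rewrite /Delta_word ?big_nil ?big_cons /=.
  rewrite /one2 /tens /of_word /=.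
  case: (u =P [::]) => [->|_]; last by rewrite mul0r eqxx.
  by case: (v =P [::]) => [->|_] //; rewrite mulr0 eqxx.
move=> h; apply/eqP; apply: contraNT h => h; apply/eqP.
apply: big1 => i _; apply: big1 => j _ /=; apply/eqP; rewrite mulf_eq0.
apply: contraNT h; rewrite negb_or => /andP[/Delta_letter_weight /= e1 /IH /= e2].
have wcat k s : weight s = (weight (take k s) + weight (drop k s))%N.
  by rewrite -{1}(cat_take_drop k s) /weight map_cat sumn_cat.
have -> : weight (a :: w) = (sval a + weight w)%N by [].
by rewrite (wcat i u) (wcat j v) -e1 -e2 addnACA.
Qed.

Lemma finite_weight n : finite_set [set w : word | (weight w <= n)%N].
Proof.
pose f (b : n.-bseq 'I_n.+1) : word := pmap insub (map val b).
apply: (@sub_finite_set _ _ (f @` setT)); last first.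
  exact/finite_image/finite_finset.
move=> w /= hw.
have szw : (size (map (fun a : letter => @inord n (sval a)) w) <= n)%N.
  rewrite size_map; apply: leq_trans hw; rewrite /weight.
  by elim: (w) => //= -[a ha] s IH /=; rewrite -(add1n (size s)) leq_add.
exists (Bseq szw) => //; rewrite /f /= -map_comp.
have : all (fun a : letter => (sval a <= n)%N) w.
  elim: w hw {szw} => //= a w IH; rewrite /weight /= => hw.
  rewrite (leq_trans (leq_addr _ _) hw) IH //.
  exact: leq_trans (leq_addl _ _) hw.
elim: w {hw szw} => //= a w IH /andP[ha /IH ->].
by rewrite inordK // valK.
Qed.

Lemma finite_Delta_word p : finite_set [set w | Delta_word K w p != 0].
Proof.
apply: sub_finite_set (finite_weight (weight p.1 + weight p.2)) => w /=.
by move/Delta_word_weight ->.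
Qed.

End FiniteSupport.

(* Main.v *)
Require Import Defs.
From HB Require Import structures.
From mathcomp Require Import all_boot all_order all_algebra.
From mathcomp Require Import boolp classical_sets functions cardinality fsbigop.

(** The coefficient of [u (x) v] in [Delta w] counts the occurrences of [w]
    among the contracting shuffles of [u] and [v] ([Delta_word_count]).  Indeed
    both numbers obey the quasi-shuffle recursion: the first letter [c] of [w]
    is either the first letter [a] of [u], or the first letter [b] of [v], or
    the sum [a + b].  On the coproduct side these are the three possibilities
    left by [Delta_letter c], which only involves words of length at most one
    ([Delta_letterE], [mul2_cons_cons]); on the combinatorial side they say how
    the path starts ([count_csh_cons_cons]): a contracted pair is an [inl]
    immediately followed by an [inr], so marking such pairs in a shuffle is the
    same as giving a path with left, right and diagonal steps, and no path is
    obtained twice.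

    By linearity the coefficient of [u (x) v] in [Delta P] is the sum of [P]
    over [csh u v] ([Delta_csh]).  For nonempty [u] and [v] the right-hand side
    [P (x) 1 + 1 (x) P] of the primitivity equation vanishes at [(u, v)], which
    gives exactly the alternel relations.  When [u] or [v] is empty, [csh u v]
    consists of the other word alone, and the equation reduces to the vanishing
    of the constant term. *)

Set Implicit Arguments.
Unset Strict Implicit.
Unset Printing Implicit Defensive.

Import GRing.Theory.
Local Open Scope ring_scope.

(** * Contracting shuffles *)

Lemma csh0w v : csh [::] v = [:: v].
Proof.
rewrite /csh /= cats0; elim: v => [|b v IH] //=.
by rewrite IH.
Qed.

Lemma cshw0 u : csh u [::] = [:: u].
Proof.
have -> : csh u [::] = contractions (map inl u).
  by case: u => [|a u]; rewrite /csh /= ?cats0.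
elim: u => [|a u IH] //.
have -> : contractions (map inl (a :: u)) =
    map (cons a) (contractions (map inl u)).
  by case: {IH} u => [|a' u] //=; rewrite cats0.
by rewrite IH.
Qed.

(** The contractions of [inl a :: s] in which [a] is merged with its
    successor. *)
Definition head_contractions (a : letter) (s : seq (letter + letter)) :
    seq word :=
  if s is inr b :: s' then map (cons (add_letter a b)) (contractions s')
  else [::].

Lemma count_contractions_inl (p : pred word) a ss :
  count p (flatten (map contractions (map (cons (inl a)) ss))) =
  (count p (map (cons a) (flatten (map contractions ss))) +
   count p (flatten (map (head_contractions a) ss)))%N.
Proof.
elim: ss => //= s ss IH.
by rewrite map_cat !count_cat IH addnACA.
Qed.

Lemma flatten_contractions_inr b ss :
  flatten (map contractions (map (cons (inr b)) ss)) =
  map (cons b) (flatten (map contractions ss)).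
Proof. by elim: ss => //= s ss ->; rewrite cats0 map_cat. Qed.

(** The letter [a] can only be merged with [b], and this forces [b] to come
    right after [a], that is first in the shuffle of the remaining letters. *)
Lemma flatten_head_contractions a b u v :
  flatten (map (head_contractions a)
    (shuffle (map inl u) (map inr (b :: v)))) =
  map (cons (add_letter a b)) (csh u v).
Proof.
rewrite /csh; case: u => [|a' u]; first by rewrite /= !cats0.
have -> : shuffle (map inl (a' :: u)) (map inr (b :: v)) =
    map (cons (inl a')) (shuffle (map inl u) (map inr (b :: v))) ++
    map (cons (inr b)) (shuffle (map inl (a' :: u)) (map inr v)) by [].
rewrite map_cat flatten_cat.
set s1 := shuffle (map inl u) _; set s2 := shuffle _ (map inr v).
have -> : flatten (map (head_contractions a) (map (cons (inl a')) s1)) = [::].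
  by elim: s1.
by rewrite cat0s; elim: s2 => //= s ss ->; rewrite map_cat.
Qed.

Lemma count_csh_cons_cons (p : pred word) a u b v :
  count p (csh (a :: u) (b :: v)) =
  (count p (map (cons a) (csh u (b :: v))) +
   count p (map (cons b) (csh (a :: u) v)) +
   count p (map (cons (add_letter a b)) (csh u v)))%N.
Proof.
rewrite -flatten_head_contractions addnAC -count_contractions_inl.
by rewrite -flatten_contractions_inr -count_cat -flatten_cat -map_cat.
Qed.

Lemma count_map_cons (T : eqType) (a c : T) w ss :
  count_mem (c :: w) (map (cons a) ss) = ((a == c) * count_mem w ss)%N.
Proof.
rewrite count_map; case: eqP => [->|ne].
  by rewrite mul1n; apply: eq_count => s /=; rewrite eqseq_cons eqxx.
rewrite mul0n -(count_pred0 ss); apply: eq_count => s /=.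
by rewrite eqseq_cons; case: eqP ne.
Qed.

Lemma count_nil_map_cons (T : eqType) (a : T) ss :
  count_mem [::] (map (cons a) ss) = 0%N.
Proof. by rewrite count_map -(count_pred0 ss); apply: eq_count. Qed.

Lemma count_nil_csh u v :
  count_mem [::] (csh u v) = ((u == [::]) && (v == [::])) :> nat.
Proof.
case: u v => [|a u] [|b v]; rewrite ?csh0w ?cshw0 //.
by rewrite count_csh_cons_cons !count_nil_map_cons.
Qed.

(** * The coproduct of a word *)

Definition weight (w : word) : nat := sumn (map sval w).

Lemma eq_y (u : word) i : (u == y i) = (size u <= 1)%N && (weight u == i).
Proof.
rewrite /y; case: insubP => [a _ <-|].
  case: u => [|b [|b' u]]; rewrite /weight //=.
    by case: a => -[].
  by rewrite addn0 eqseq_cons andbT.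
by rewrite eqseq_cons andbF.
rewrite -eqn0Ngt => /eqP ->; case: u => [|b [|b' u]] //=.
by rewrite /weight /= addn0 eqn0Ngt (svalP b).
Qed.

Section Coproduct.
Variable K : fieldType.
Implicit Types (F : ncseries2 K) (P : ncseries K).

(** Since [y i] has weight [i], at most one term of the sum defining
    [Delta_letter c] contributes to a given pair of words. *)
Lemma Delta_letterE c u v :
  Delta_letter K c (u, v) =
  [&& size u <= 1, size v <= 1 & weight u + weight v == sval c]%N%:R.
Proof.
rewrite /Delta_letter /tens /of_word /=.
under eq_bigr => i _ do rewrite !eq_y -natrM mulnb.
have [le_uc|lt_cu] := leqP (weight u) (sval c); last first.
  rewrite big1 => [|i _]; last first.
    case: (weight u =P i) => [e|_]; last by rewrite andbF.
    by move: (ltn_ord i); rewrite ltnS -e leqNgt lt_cu.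
  by rewrite (gtn_eqF (leq_trans lt_cu (leq_addr _ _))) !andbF.
rewrite (bigD1 (inord (weight u))) //= inordK // eqxx andbT big1 ?addr0.
  congr (_%:R); congr (nat_of_bool _); congr [&& _, _ & _].
  by rewrite -(eqn_add2l (weight u)) subnKC.
move=> i ne_iu; case: (weight u =P i) => [e|_]; last by rewrite andbF.
by move: ne_iu; rewrite e inord_val eqxx.
Qed.

Lemma Delta_letter00 c : Delta_letter K c ([::], [::]) = 0.
Proof. by rewrite Delta_letterE /= eq_sym eqn0Ngt (svalP c). Qed.

Lemma Delta_letter10 c a : Delta_letter K c ([:: a], [::]) = (a == c)%:R.
Proof. by rewrite Delta_letterE /weight /= !addn0. Qed.

Lemma Delta_letter01 c b : Delta_letter K c ([::], [:: b]) = (b == c)%:R.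
Proof. by rewrite Delta_letterE /weight /= addn0. Qed.

Lemma Delta_letter11 c a b :
  Delta_letter K c ([:: a], [:: b]) = (add_letter a b == c)%:R.
Proof. by rewrite Delta_letterE /weight /= !addn0. Qed.

Lemma sum_ord_first2 n (f : nat -> K) :
  (forall i, (i < n)%N -> f i.+2 = 0) -> \sum_(i < n.+2) f i = f 0%N + f 1%N.
Proof.
by move=> f0; rewrite !big_ord_recl /= big1 ?addr0 // => i _; rewrite f0.
Qed.

Lemma mul2_nil_nil c F : mul2 (Delta_letter K c) F ([::], [::]) = 0.
Proof. by rewrite /mul2 /= !big_ord1 /= Delta_letter00 mul0r. Qed.

Lemma Delta_letter_long c u v :
  (1 < size u)%N || (1 < size v)%N -> Delta_letter K c (u, v) = 0.
Proof.
by rewrite Delta_letterE => /orP[]; rewrite ltnNge => /negPf ->; rewrite ?andbF.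
Qed.

Lemma mul2_cons_nil c F a u :
  mul2 (Delta_letter K c) F (a :: u, [::]) = (a == c)%:R * F (u, [::]).
Proof.
rewrite /mul2 /=; under eq_bigr => i _ do rewrite big_ord1 /=.
rewrite (sum_ord_first2 (f := fun i => Delta_letter K c (take i (a :: u), [::])
  * F (drop i (a :: u), [::]))) /=.
  by rewrite take0 drop0 Delta_letter00 Delta_letter10 mul0r add0r.
by move=> i lt_iu; rewrite Delta_letter_long ?mul0r //= size_takel.
Qed.

Lemma mul2_nil_cons c F b v :
  mul2 (Delta_letter K c) F ([::], b :: v) = (b == c)%:R * F ([::], v).
Proof.
rewrite /mul2 /= big_ord1 /=.
rewrite (sum_ord_first2 (f := fun j => Delta_letter K c ([::], take j (b :: v))
  * F ([::], drop j (b :: v)))) /=.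
  by rewrite take0 drop0 Delta_letter00 Delta_letter01 mul0r add0r.
by move=> j lt_jv; rewrite Delta_letter_long ?mul0r //= size_takel ?orbT.
Qed.

Lemma mul2_cons_cons c F a u b v :
  mul2 (Delta_letter K c) F (a :: u, b :: v) =
  (a == c)%:R * F (u, b :: v) + (b == c)%:R * F (a :: u, v) +
  (add_letter a b == c)%:R * F (u, v).
Proof.
pose f i j := Delta_letter K c (take i (a :: u), take j (b :: v))
  * F (drop i (a :: u), drop j (b :: v)).
have f_row i : \sum_(j < (size v).+2) f i j = f i 0%N + f i 1%N.
  apply: sum_ord_first2 => j lt_jv.
  by rewrite /f Delta_letter_long ?mul0r //= [size (take j.+1 v)]size_takel ?orbT.
have -> : mul2 (Delta_letter K c) F (a :: u, b :: v) =
    f 0%N 0%N + f 0%N 1%N + (f 1%N 0%N + f 1%N 1%N).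
  rewrite /mul2 /=; under eq_bigr => i _ do rewrite (f_row i).
  rewrite (sum_ord_first2 (f := fun i => f i 0%N + f i 1%N)) // => i lt_iu.
  by rewrite /f !Delta_letter_long ?mul0r ?addr0 //= size_takel.
rewrite /f /= !take0 !drop0 Delta_letter00 Delta_letter01 Delta_letter10.
by rewrite Delta_letter11 mul0r add0r addrCA addrA.
Qed.

(** Both sides satisfy the quasi-shuffle recursion, with the same initial
    values. *)
Lemma Delta_word_count w u v :
  Delta_word K w (u, v) = (count_mem w (csh u v))%:R.
Proof.
elim: w u v => [|c w IH] u v; rewrite /Delta_word ?big_nil ?big_cons.
  by rewrite /one2 /tens /of_word /= -natrM mulnb count_nil_csh.
rewrite -/(Delta_word K w).
case: u v => [|a u] [|b v].
- by rewrite mul2_nil_nil csh0w.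
- by rewrite mul2_nil_cons IH !csh0w -natrM -count_map_cons.
- by rewrite mul2_cons_nil IH !cshw0 -natrM -count_map_cons.
- rewrite mul2_cons_cons !IH count_csh_cons_cons !count_map_cons.
  by rewrite !natrD !natrM.
Qed.

(** Grouping the equal words of [csh u v] turns a sum over this list into a sum
    over all words. *)
Lemma Delta_csh P u v : Delta P (u, v) = \sum_(w <- csh u v) P w.
Proof.
rewrite /Delta -[RHS]big_undup_iterop_count.
rewrite (fsbigE (undup (csh u v))) ?undup_uniq // => [|w _].
  apply: eq_big => [w|w _]; first by rewrite in_setT.
  by rewrite Delta_word_count mulr_natr.
by rewrite mem_undup Delta_word_count => /count_memPn ->; rewrite mulr0.
Qed.

End Coproduct.

(** * Primitive series *)

Theorem mainTheorem2 (K : fieldType) (charK : [pchar K]%R =i pred0)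
    (M : mould K) :
  primitive (series_of_mould M) <-> M [::] = 0%R /\ alternel M.
Proof.
pose P := series_of_mould M.
pose R := tens P (of_word K [::]) + tens (of_word K [::]) P.
have RE u v : R (u, v) = M u * (v == [::])%:R + (u == [::])%:R * M v by [].
have R_nil_l v : R ([::], v) = M [::] * (v == [::])%:R + M v.
  by rewrite RE eqxx mul1r.
have R_nil_r u : R (u, [::]) = M u + (u == [::])%:R * M [::].
  by rewrite RE eqxx mulr1.
have R_cons a u b v : R (a :: u, b :: v) = 0.
  by rewrite RE mulr0 mul0r addr0.
split=> [primM|[M0 altM]].
  have csh_R u v : \sum_(w <- csh u v) M w = R (u, v).
    by rewrite -(Delta_csh P) [Delta P]primM.
  split; last by case=> [|a u] [|b v] // _ _; rewrite csh_R R_cons.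
  (* At the pair of empty words the equation reads M 1 = M 1 + M 1. *)
  have := csh_R [::] [::]; rewrite csh0w big_seq1 R_nil_l eqxx mulr1.
  by rewrite -[LHS]addr0 => /addrI.
apply/funext => -[u v]; rewrite -/P -/R Delta_csh.
case: u v => [|a u] [|b v].
- by rewrite csh0w big_seq1 R_nil_l M0 mul0r add0r.
- by rewrite csh0w big_seq1 R_nil_l M0 mul0r add0r.
- by rewrite cshw0 big_seq1 R_nil_r M0 mulr0 addr0.
- by rewrite R_cons; apply: altM.
Qed.
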